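(* Let $n\in\mathbb{N}$ and let $\mathbf{s}=(s_0,\ldots,s_n)\subset[0,\infty)$ be positive on $(0,\infty)$. Set $K=\mathrm{ind}_\infty(\mathbf{s})$ and $N=2K-1$. Then (i) $s_k\in\big(t_\infty((s_{k+1},\ldots,s_n)),\infty\big)$ for $k\in\mathbb{N}\cap[n-N,n-1]$; (ii) $s_k=t_\infty((s_{k+1},\ldots,s_{k+N+1}))$ for $k\in\mathbb{N}\cap[0,n-N-1]$.
   Context: For $a<b$ and a finite sequence $\mathbf{u}=(u_0,\ldots,u_m)$, $\mathbf{u}$ is positive on $[a,b]$ if the linear functional $\sigma(x^k)=u_k$ is $\ge0$ on every real polynomial of degree $\le m$ nonnegative on $[a,b]$; positive on $(0,\infty)$ means positive on some $[a,b]\subset(0,\infty)$. $\mathcal{M}_{a,b}(\mathbf{u})$ is the set of positive Borel measures on $[a,b]$ with $k$-th moments $u_k$ ($k\le m$); $\mathcal{M}_\infty(\mathbf{u})$ is the set of positive Borel measures on $(0,\infty)$ supported in a compact $[a,b]\subset(0,\infty)$ with these moments; $\mathrm{ind}_\infty(\mathbf{u})=\min\{\#\mathrm{supp}\,\mu:\mu\in\mathcal{M}_\infty(\mathbf{u})\}$. $t_{a,b}(\mathbf{u})=\inf\{\int_{[a,b]}\frac1t\,d\mu:\mu\in\mathcal{M}_{a,b}(\mathbf{u})\}$ ($\inf\varnothing=\infty$) and $t_\infty(\mathbf{u})=\inf_{0<a<b}t_{a,b}(\mathbf{u})$. *)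

(* Defs.v *)
From HB Require Import structures.
From mathcomp Require Import all_boot all_order all_algebra.
From mathcomp Require Import all_classical all_reals all_analysis.
Set Implicit Arguments. Unset Strict Implicit. Unset Printing Implicit Defensive.
Import Order.TTheory GRing.Theory Num.Theory.
Import numFieldNormedType.Exports.
Local Open Scope classical_set_scope.
Local Open Scope ring_scope.

(* A finite sequence (u_0, ..., u_{L-1}) is encoded by its length L and
   u : nat -> R (values beyond index L-1 are irrelevant).  The paper's
   (u_0,...,u_m) has L = m+1; the degree bound "deg p <= m" becomes
   "size p <= L". *)

Definition pos_ab (R : realType) (L : nat) (u : nat -> R) (a b : R) : Prop :=
  forall p : {poly R}, (size p <= L)%N ->
    (forall x : R, a <= x <= b -> 0 <= p.[x]) ->
    0 <= \sum_(i < L) p`_i * u i.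

Definition pos_inf (R : realType) (L : nat) (u : nat -> R) : Prop :=
  exists a b : R, 0 < a /\ a < b /\ pos_ab L u a b.

Definition in_M_ab (R : realType) (L : nat) (u : nat -> R) (a b : R)
    (mu : {measure set R -> \bar R}) : Prop :=
  mu (~` `[a, b]) = 0%E /\
  forall k : nat, (k < L)%N -> (\int[mu]_(x in `[a, b]) (x ^+ k)%:E = (u k)%:E)%E.

Definition in_M_inf (R : realType) (L : nat) (u : nat -> R)
    (mu : {measure set R -> \bar R}) : Prop :=
  exists a b : R, 0 < a /\ a < b /\ in_M_ab L u a b mu.

Definition msupp (R : realType) (mu : {measure set R -> \bar R}) : set R :=
  [set x | forall e : R, 0 < e -> (0 < mu (ball x e))%E].

Definition is_ind_inf (R : realType) (L : nat) (u : nat -> R) (K : nat) : Prop :=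
  (exists mu, in_M_inf L u mu /\ (msupp mu #= `I_K)%card) /\
  forall (mu : {measure set R -> \bar R}) (K' : nat),
    in_M_inf L u mu -> (msupp mu #= `I_K')%card -> (K <= K')%N.

(* ind_oo(u) (junk value 0 if the minimum does not exist) *)
Definition ind_inf (R : realType) (L : nat) (u : nat -> R) : nat :=
  xget 0%N [set K | is_ind_inf L u K].

(* t_{a,b}(u) = inf { int_[a,b] 1/t dmu : mu in M_{a,b}(u) }, inf of empty = +oo *)
Definition t_ab (R : realType) (L : nat) (u : nat -> R) (a b : R) : \bar R :=
  ereal_inf [set (\int[mu]_(x in `[a, b]) (x^-1)%:E)%E
            | mu in [set mu : {measure set R -> \bar R} | in_M_ab L u a b mu]].

Definition t_inf (R : realType) (L : nat) (u : nat -> R) : \bar R :=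
  ereal_inf [set t_ab L u ab.1 ab.2 | ab in [set ab : R * R | 0 < ab.1 /\ ab.1 < ab.2]].

(* Main.v *)
Require Import Defs.
From HB Require Import structures.
From mathcomp Require Import all_boot all_order all_algebra.
From mathcomp Require Import all_classical all_reals all_analysis.
From mathcomp Require Import measurable_realfun zify ring lra.
Import Order.TTheory GRing.Theory Num.Theory.
Import numFieldNormedType.Exports.
Local Open Scope classical_set_scope.
Local Open Scope ring_scope.

(* A sequence positive on [a, b] has a finitely atomic representing measure: the
   point of the compact convex set {sum_j c_j (x_j^k)_k : c_j >= 0, sum_j c_j =
   u_0, x_j in [a, b]} closest to u yields, by its variational inequality, a
   polynomial that is nonnegative on [a, b], and positivity of u forces the
   distance to be 0.  So a minimal measure exists; let x_1, ..., x_K be its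
   atoms.

   (ii) Define q, of degree at most 2K - 1, by 1 - t q(t) = prod_j (1 - t/x_j)^2.
   Then q(t) <= 1/t on (0, oo), with equality at every x_j, so integrating q
   shows that t^(k+1) times the minimal measure minimises the integral of 1/t.

   (i) When at most 2K moments s_k, ..., s_n are involved, evaluation at 0 is a
   combination of the point evaluations at the x_j and at K further points close
   to them (Lagrange interpolation).  A small multiple of minus this combination
   can be added to the atomic measure without losing positivity; it lowers s_k
   and preserves s_(k+1), ..., s_n. *)

(** * Finite bounds, interpolation and linear dependence *)

(** Take the inverse of one plus the sum of all 1/f(i): the extra one makes the bound strict and
    covers an empty [T]. *)
Lemma finite_pos_lb (R : realType) (T : finType) (f : T -> R) :
  (forall i, 0 < f i) -> exists2 d : R, 0 < d & forall i, d < f i.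
Proof.
move=> f0; have S0 : 0 <= \sum_i (f i)^-1.
  by apply: sumr_ge0 => i _; rewrite invr_ge0 ltW.
have S1 : 0 < 1 + \sum_i (f i)^-1 by rewrite ltr_pwDl.
exists (1 + \sum_i (f i)^-1)^-1 => [|i]; first by rewrite invr_gt0.
rewrite -[ltRHS]invrK ltf_pV2 ?posrE ?invr_gt0//.
rewrite (bigD1 i)//= addrCA ltrDl ltr_pwDl// sumr_ge0// => j _.
by rewrite invr_ge0 ltW.
Qed.

(** The difference of [p] and its interpolant has size at most #|I| but vanishes at #|I| distinct
    points. *)
Lemma lagrange_interpolation (F : fieldType) (I : finType) (z : I -> F)
    (p : {poly F}) (y : F) : injective z -> (size p <= #|I|)%N ->
  p.[y] = \sum_l p.[z l] * \prod_(r | r != l) ((y - z r) / (z l - z r)).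
Proof.
move=> zi sp.
pose L l := \prod_(r | r != l) ((z l - z r)^-1 *: ('X - (z r)%:P)).
have LE l t : (L l).[t] = \prod_(r | r != l) ((t - z r) / (z l - z r)).
  rewrite /L horner_prod; apply: eq_bigr => r _.
  by rewrite hornerZ hornerXsubC mulrC.
pose q := p - \sum_l p.[z l] *: L l.
have qE t : q.[t] =
    p.[t] - \sum_l p.[z l] * \prod_(r | r != l) ((t - z r) / (z l - z r)).
  rewrite /q hornerD hornerN horner_sum; congr (_ - _).
  by apply: eq_bigr => l _; rewrite hornerZ LE.
suff q0 : q = 0.
  by apply/eqP; rewrite -subr_eq0 -qE q0 horner0.
apply/eqP/negPn/negP => /max_poly_roots.
move=> /(_ [seq z i | i <- enum I]); rewrite size_map -cardE ltnNge.
have -> : (size q <= #|I|)%N.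
  rewrite (leq_trans (size_polyD _ _))// geq_max sp size_polyN.
  apply: (leq_trans (size_sum _ _ _)); apply/bigmax_leqP => l _.
  apply: (leq_trans (size_scale_leq _ _)).
  rewrite /L scaler_prod; apply: (leq_trans (size_scale_leq _ _)).
  apply: (leq_trans (size_prod_leq _ _)).
  under eq_bigr do rewrite size_XsubC.
  rewrite sum_nat_const cardC1 muln2 -addnn -addSn addnK.
  by rewrite prednK//; apply/card_gt0P; exists l.
move=> H; suff : false by [].
apply: H; last by rewrite map_inj_uniq ?enum_uniq.
apply/allP => _ /mapP[i _ ->]; rewrite /root qE (bigD1 i)//= big1 => [|r ri].
  rewrite mulr1 big1 ?addr0 ?subrr// => j ji.
  by rewrite (bigD1 i)/= ?subrr ?mul0r ?mulr0// eq_sym.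
by rewrite divff// subr_eq0 (inj_eq zi) eq_sym.
Qed.

(** The L + 1 vectors (x_i^k) with k < L are linearly dependent. Subtracting the largest multiple of
    a dependency that keeps all weights nonnegative makes one weight vanish. *)
Lemma caratheodory_reduce (F : realFieldType) (L : nat) (c x : 'I_L.+1 -> F) :
  (forall j, 0 <= c j) ->
  exists (c' : 'I_L -> F) (h : 'I_L -> 'I_L.+1), (forall j, 0 <= c' j) /\
    forall k, (k < L)%N ->
      \sum_j c' j * x (h j) ^+ k = \sum_j c j * x j ^+ k.
Proof.
move=> c0.
pose A : 'M[F]_(L.+1, L) := \matrix_(i, k) x i ^+ k.
have [v vA [i0 vi0]] : exists2 v : 'I_L.+1 -> F,
    (forall k, (k < L)%N -> \sum_i v i * x i ^+ k = 0) & exists i, 0 < v i.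
  have : kermx A != 0.
    rewrite -mxrank_eq0 mxrank_ker subn_eq0 -ltnNge.
    exact: leq_ltn_trans (rank_leq_col A) _.
  move=> /rowV0Pn[v /sub_kermxP vA v0].
  have vA' k : (k < L)%N -> \sum_i v ord0 i * x i ^+ k = 0.
    move=> kL; move/rowP/(_ (Ordinal kL)): vA; rewrite !mxE => vA.
    by rewrite -[RHS]vA; apply: eq_bigr => i _; rewrite mxE.
  have [i vi] : exists i, v ord0 i != 0.
    apply/existsP; apply: contraNT v0 => /existsPn v0.
    by apply/eqP/rowP => i; rewrite mxE; have /negPn/eqP := v0 i.
  have [vi0|vi0] := ltP 0 (v ord0 i).
    by exists (v ord0) => //; exists i.
  exists (fun i => - v ord0 i).
    move=> k kL; under eq_bigr do rewrite mulNr.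
    by rewrite sumrN vA'// oppr0.
  by exists i; rewrite oppr_gt0 lt_neqAle vi.
have [i vi imin] := @Order.TotalTheory.arg_minP _ _ _ i0 (fun i => 0 < v i)
  (fun i => c i / v i) vi0.
pose t := c i / v i.
have t0 : 0 <= t by rewrite divr_ge0// ltW.
pose c1 j := c j - t * v j.
have c1i : c1 i = 0 by rewrite /c1 /t divfK ?subrr// gt_eqF.
exists (fun j => c1 (lift i j)), (lift i); split.
  move=> j; rewrite subr_ge0; have [vj|vj] := ltP 0 (v (lift i j)).
    by rewrite -ler_pdivlMr//; exact: imin.
  by rewrite (le_trans _ (c0 _))// mulr_ge0_le0.
move=> k kL; transitivity (\sum_j c1 j * x j ^+ k).
  by rewrite (bigD1_ord i)//= c1i mul0r add0r.
under eq_bigr do rewrite mulrBl -mulrA.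
by rewrite sumrB -mulr_sumr vA// mulr0 subr0.
Qed.

(** First-order condition: it turns minimality of a squared distance along a segment into an
    inequality for the derivative at 0. *)
Lemma slope_ge0 (F : realFieldType) (al B : F) : 0 <= B ->
  (forall t, 0 <= t <= 1 -> 0 <= t * al *+ 2 + t ^+ 2 * B) -> 0 <= al.
Proof.
move=> B0 H; rewrite leNgt; apply/negP => al0.
have Bal : 0 < B - al by rewrite subr_gt0 (lt_le_trans al0).
(* This [t] is at most 1 and satisfies t B <= -al, so 2 al + t B <= al < 0. *)
pose t := - al / (B - al).
have t0 : 0 < t by rewrite divr_gt0// oppr_gt0.
have t1 : t <= 1 by rewrite ler_pdivrMr// mul1r lerDr.
have tB : t * B <= - al.
  by rewrite /t mulrAC ler_pdivrMr// ler_wpM2l ?lerDl ?oppr_ge0// ltW.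
have := H t; rewrite (ltW t0) t1 => /(_ isT).
rewrite expr2 -mulrA -mulrnAr -mulrDr pmulr_rge0//; lra.
Qed.

(** * Atomic representation of positive sequences *)

Lemma moment_distance_continuous (R : realType) (L M : nat) (u : nat -> R) :
  continuous (fun z : 'rV[R]_M * 'rV[R]_M =>
    \sum_(k < L) (u k - \sum_j z.1 ord0 j * z.2 ord0 j ^+ k) ^+ 2).
Proof.
have sumC (N : nat) (G : 'I_N -> 'rV[R]_M * 'rV[R]_M -> R) :
    (forall i, continuous (G i)) -> continuous (fun z => \sum_i G i z).
  move=> cG; apply: continuous_big => [|i _]; [exact: add_continuous|exact: cG].
apply: (@sumC L) => k z.
apply: (@cvg_comp _ _ _
  (fun z : 'rV[R]_M * 'rV[R]_M => u k - \sum_j z.1 ord0 j * z.2 ord0 j ^+ k)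
  (fun y : R => y ^+ 2) _ _ _ _ (@exprn_continuous _ 2 _)).
apply: cvgB; first exact: cvg_cst.
apply: (@sumC M) => j {}z.
have c1 : (fun z : 'rV[R]_M * 'rV[R]_M => z.1 ord0 j) @ z --> z.1 ord0 j.
  apply: (@cvg_comp _ _ _ fst (fun y : 'rV[R]_M => y ord0 j)); first exact: cvg_fst.
  exact: coord_continuous.
have c2 : (fun z : 'rV[R]_M * 'rV[R]_M => z.2 ord0 j) @ z --> z.2 ord0 j.
  apply: (@cvg_comp _ _ _ snd (fun y : 'rV[R]_M => y ord0 j)); first exact: cvg_snd.
  exact: coord_continuous.
apply: cvgM => //.
by apply: (@cvg_comp _ _ _ _ (fun y : R => y ^+ k) _ _ _ c2); exact: exprn_continuous.
Qed.

(** Fixing the total mass [m] bounds every weight by [m], so the admissible weights and nodes form a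
    compact set. *)
Lemma moment_distance_min (R : realType) (L M : nat) (u : nat -> R) (a b m : R) :
  a <= b -> 0 <= m ->
  exists c x : 'I_M.+1 -> R,
    [/\ forall j, 0 <= c j, forall j, a <= x j <= b, \sum_j c j = m &
     forall c' x' : 'I_M.+1 -> R, (forall j, 0 <= c' j) ->
       (forall j, a <= x' j <= b) -> \sum_j c' j = m ->
       \sum_(k < L) (u k - \sum_j c j * x j ^+ k) ^+ 2 <=
       \sum_(k < L) (u k - \sum_j c' j * x' j ^+ k) ^+ 2].
Proof.
move=> ab m0.
pose box (p q : R) := [set v : 'rV[R]_M.+1 | forall j, `[p, q]%classic (v ord0 j)].
pose A := (box 0 m `*` box a b) `&`
  ((fun z : 'rV[R]_M.+1 * 'rV[R]_M.+1 => \sum_j z.1 ord0 j) @^-1` [set m]).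
have boxc p q : compact (box p q).
  by apply: (@rV_compact _ _ (fun=> `[p, q]%classic)) => _; exact: segment_compact.
have Ac : compact A.
  apply: compact_closedI; first exact: compact_setX.
  apply: preimage_closed => [z _|]; last exact: closed_eq.
  apply: continuous_big => [|i _ {}z]; first exact: add_continuous.
  apply: (@cvg_comp _ _ _ fst (fun y : 'rV[R]_M.+1 => y ord0 i)); first exact: cvg_fst.
  exact: coord_continuous.
have inA c x : (forall j, 0 <= c j) -> (forall j, a <= x j <= b) ->
    \sum_j c j = m -> A (\row_j c j, \row_j x j).
  move=> c0 xab cm; split => /=.
    split => j /=; rewrite mxE in_itv/= ?xab// c0/= -cm.
    by rewrite (bigD1 j)//= lerDl sumr_ge0.
  by rewrite /= -cm; apply: eq_bigr => j _; rewrite mxE.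
have A0 : A !=set0.
  exists (\row_j (if j == ord0 then m else 0), \row__ a); apply: inA => [j|j|].
  - by case: ifP.
  - by rewrite lexx.
  - by rewrite -big_mkcond big_pred1_eq.
have [[c x] /[!inE] -[[/= cb xb] cm] cxmin] := compact_EVT_min A0 Ac
  (continuous_subspaceT (@moment_distance_continuous R L M.+1 u)).
exists (c ord0), (x ord0); split => //.
- by move=> j; have := cb j; rewrite /= in_itv/= => /andP[].
- by move=> c' x' c0 xab cm'; have := cxmin _ (mem_set (inA _ _ c0 xab cm')) => /=;
  under [leRHS]eq_bigr do under eq_bigr do rewrite !mxE.
Qed.

Lemma pos_ab_atomic (R : realType) (L : nat) (u : nat -> R) (a b : R) :
  0 <= a -> a <= b -> pos_ab L.+1 u a b ->
  exists c x : 'I_L.+1 -> R, [/\ forall j, 0 <= c j, forall j, a <= x j <= b &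
    forall k, (k < L.+1)%N -> \sum_j c j * x j ^+ k = u k].
Proof.
move=> a0 ab up.
pose Lam (p : {poly R}) := \sum_(i < L.+1) p`_i * u i.
have LamX k : (k < L.+1)%N -> Lam 'X^k = u k.
  move=> kL; rewrite /Lam (bigD1 (Ordinal kL))//= coefXn eqxx mul1r.
  rewrite big1 ?addr0// => i ik; rewrite coefXn.
  by rewrite (_ : (i == k :> nat) = false) ?mul0r//; apply/negbTE.
have LamC m : Lam m%:P = m * u 0%N.
  rewrite /Lam big_ord_recl coefC/= big1 ?addr0// => i _.
  by rewrite coefC mul0r.
have LamB (p q : {poly R}) : Lam (p - q) = Lam p - Lam q.
  by rewrite /Lam -sumrB; apply: eq_bigr => i _; rewrite coefB mulrBl.
have Lam0 (p : {poly R}) : (size p <= L.+1)%N -> (forall x, a <= x <= b -> 0 <= p.[x]) ->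
  0 <= Lam p := @up p.
have u0 k : (k < L.+1)%N -> 0 <= u k.
  move=> kL; rewrite -LamX//; apply: Lam0; first by rewrite size_polyXn.
  by move=> x /andP[ax _]; rewrite hornerXn exprn_ge0// (le_trans a0).
have [c [x [c0 xab cm cmin]]] :=
  @moment_distance_min R L.+1 L u a b (u 0%N) ab (u0 0%N isT).
exists c, x; split => //.
pose w k := \sum_j c j * x j ^+ k.
pose g k := w k - u k.
suff g0 : \sum_(k < L.+1) g k ^+ 2 = 0.
  move=> k kL; apply/eqP; rewrite -subr_eq0 -sqrf_eq0.
  have /psumr_eq0P/(_ g0 (Ordinal kL) isT)-> // : forall i : 'I_L.+1,
    true -> 0 <= g i ^+ 2 by move=> i _; exact: sqr_ge0.
(* Variational inequality: moving from the minimiser [w] towards the moment vector of a mass u_0 at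
   [y] cannot decrease the distance to [u]. *)
have var y : a <= y <= b -> 0 <= \sum_(k < L.+1) g k * (u 0%N * y ^+ k - w k).
  move=> yab; apply: (@slope_ge0 _ _ (\sum_(k < L.+1) (u 0%N * y ^+ k - w k) ^+ 2)).
    by apply: sumr_ge0 => i _; exact: sqr_ge0.
  move=> t /andP[t0 t1].
  (* A point of this segment uses one atom too many; [caratheodory_reduce] returns to L + 1 atoms
     with the same moments, so minimality applies. *)
  pose C (j : 'I_L.+2) := if unlift ord0 j is Some i then (1 - t) * c i else t * u 0%N.
  pose X (j : 'I_L.+2) := if unlift ord0 j is Some i then x i else y.
  have C0 j : 0 <= C j.
    rewrite /C; case: unliftP => [i|] _; last by rewrite mulr_ge0// u0.
    by rewrite mulr_ge0// subr_ge0.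
  have CX k : \sum_j C j * X j ^+ k = (1 - t) * w k + t * (u 0%N * y ^+ k).
    rewrite big_ord_recl {1}/C {1}/X unlift_none addrC mulrA; congr (_ + _).
    rewrite mulr_sumr; apply: eq_bigr => i _.
    by rewrite /C /X liftK mulrA.
  have [c' [h [c'0 c'E]]] := @caratheodory_reduce _ L.+1 C X C0.
  have Xh j : a <= (X \o h) j <= b by rewrite /= /X; case: unliftP.
  have c'm : \sum_j c' j = u 0%N.
    have := c'E 0%N isT; under eq_bigr do rewrite expr0 mulr1.
    move=> ->; rewrite CX /w; under eq_bigr do rewrite expr0 mulr1.
    by rewrite cm expr0 mulr1 -mulrDl subrK mul1r.
  have := cmin c' (X \o h) c'0 Xh c'm; rewrite -subr_ge0 => /le_trans; apply.
  rewrite -sumrB !mulr_sumr -sumrMnl -big_split/= le_eqVlt; apply/orP; left.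
  apply/eqP; apply: eq_bigr => k _; rewrite c'E// CX /g -/(w k); ring.
(* The polynomial u_0 sum_k g_k X^k - G is nonnegative on [a, b] by [var], while the functional
   sends it to -u_0 |g|^2. *)
pose G := \sum_(k < L.+1) g k * w k.
have := Lam0 (u 0%N *: \poly_(k < L.+1) g k - G%:P).
have -> : Lam (u 0%N *: \poly_(k < L.+1) g k - G%:P) =
    - (u 0%N * \sum_(k < L.+1) g k ^+ 2).
  rewrite LamB LamC /G mulr_suml mulr_sumr -sumrB -sumrN.
  apply: eq_bigr => k _; rewrite coefZ coef_poly ltn_ord /g; ring.
(* For u_0 = 0, positivity on b^k - X^k forces every u_k to vanish; the weights vanish since their
   sum is u_0. *)
have [u00|u00] := eqVneq (u 0%N) 0.
  move=> _; have uk k : (k < L.+1)%N -> u k = 0.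
    move=> kL; apply/eqP; rewrite eq_le u0// andbT.
    have := Lam0 ((b ^+ k)%:P - 'X^k).
    rewrite LamB LamC LamX// u00 mulr0 sub0r oppr_ge0; apply.
      rewrite (leq_trans (size_polyD _ _))// geq_max size_polyN size_polyXn kL.
      by rewrite (leq_trans (size_polyC_leq1 _)).
    move=> z /andP[az zb]; rewrite hornerD hornerN hornerC hornerXn subr_ge0.
    by rewrite lerXn2r// nnegrE ?(le_trans a0)// (le_trans az).
  have cj j : c j = 0.
    have /psumr_eq0P/(_ _ j isT) -> // : forall i, true -> 0 <= c i by [].
    by rewrite cm.
  apply: big1 => k _; rewrite /g uk// subr0 /w big1 ?expr0n// => j _.
  by rewrite cj mul0r.
move=> /(_ _ _)/wrap[].
- rewrite (leq_trans (size_polyD _ _))// geq_max size_polyN.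
  rewrite (leq_trans (size_scale_leq _ _)) ?size_poly//=.
  by rewrite (leq_trans (size_polyC_leq1 _)).
- move=> y yab; rewrite hornerD hornerN hornerC hornerZ horner_poly mulr_sumr.
  rewrite /G -sumrB (le_trans (var y yab))// le_eqVlt; apply/orP; left.
  by apply/eqP; apply: eq_bigr => k _; ring.
- rewrite oppr_ge0 pmulr_rle0 ?lt0r ?u00 ?u0// => s0.
  by apply/eqP; rewrite eq_le s0 sumr_ge0// => k _; exact: sqr_ge0.
Qed.

(** * Finitely atomic measures and upper bounds for [t_inf] *)

(* The pairs are (position, weight); a negative weight counts with its absolute
   value. *)
Definition atomic (R : realType) (s : seq (R * R)) : {measure set R -> \bar R} :=
  msum (fun i => mscale (NngNum (normr_ge0 (nth 0 s i).2)) (dirac (nth 0 s i).1))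
    (size s).

Lemma atomicE (R : realType) (s : seq (R * R)) (A : set R) :
  atomic R s A = (\sum_(w <- s) `|w.2|%:E * \d_(w.1) A)%E.
Proof. by rewrite (big_nth 0) big_mkord. Qed.

Lemma integral_atomic (R : realType) (s : seq (R * R)) (D : set R) (f : R -> R) :
  measurable D -> measurable_fun D f -> (forall x, D x -> 0 <= f x) ->
  (forall w, w \in s -> 0 <= w.2 /\ D w.1) ->
  (\int[atomic R s]_(x in D) (f x)%:E = (\sum_(w <- s) w.2 * f w.1)%:E)%E.
Proof.
move=> mD mf f0 sD.
have mEf : measurable_fun D (fun x => (f x)%:E) by apply/measurable_EFinP.
rewrite ge0_integral_measure_sum//= (big_nth 0) big_mkord -sumEFin.
apply: eq_bigr => i _; rewrite ge0_integral_mscale//= integral_dirac//.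
have [s0 Ds] := sD _ (mem_nth 0 (ltn_ord i)).
by rewrite diracE mem_set// mul1e ger0_norm.
Qed.

Lemma atomic_in_M_ab (R : realType) (L : nat) (u : nat -> R) (a b : R)
    (I : finType) (c x : I -> R) : 0 <= a -> (forall i, 0 <= c i) ->
  (forall i, a <= x i <= b) ->
  (forall k, (k < L)%N -> \sum_i c i * x i ^+ k = u k) ->
  in_M_ab L u a b (atomic R [seq (x i, c i) | i <- enum I]).
Proof.
move=> a0 c0 xab cxu; split.
  rewrite atomicE big_map big1_seq// => i _ /=.
  by rewrite diracE memNset ?mule0// => nx; apply: nx; rewrite /= in_itv/= xab.
move=> k kL; rewrite integral_atomic// ?big_map ?big_enum/= ?cxu//.
  move=> y /=; rewrite in_itv/= => /andP[ay _].
  by rewrite exprn_ge0// (le_trans a0).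
by move=> w /mapP[i _ ->]; rewrite /= in_itv/=.
Qed.

Lemma measurable_fun_inv_itv (R : realType) (a b : R) : 0 < a ->
  measurable_fun `[a, b]%classic (fun x : R => x^-1).
Proof.
move=> a0; apply: subspace_continuous_measurable_fun => //.
apply: continuous_in_subspaceT => x /[!inE]/= /[!in_itv]/= /andP[ax _].
by apply: inv_continuous; rewrite gt_eqF// (lt_le_trans a0).
Qed.

Lemma t_inf_le_atomic (R : realType) (L : nat) (u : nat -> R) (I : finType)
    (c x : I -> R) : (forall i, 0 <= c i) -> (forall i, 0 < x i) ->
  (forall k, (k < L)%N -> \sum_i c i * x i ^+ k = u k) ->
  (t_inf L u <= (\sum_i c i / x i)%:E)%E.
Proof.
move=> c0 x0 cxu.
have [a a0 ax] := finite_pos_lb R I x x0.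
have [b' b0 bx] := finite_pos_lb R I (fun i => (x i)^-1)
  (fun i => etrans (invr_gt0 (x i)) (x0 i)).
(* [b'] lies below every 1/x_i, so its inverse bounds the nodes; [a + 1] ensures a < b. *)
pose b := Num.max b'^-1 (a + 1).
have ab : a < b by rewrite lt_max ltrDl ltr01 orbT.
have xab i : a <= x i <= b.
  rewrite (ltW (ax i)) le_max -[x i]invrK lef_pV2 ?posrE ?invr_gt0//.
  by rewrite ltW ?bx.
apply: (@le_trans _ _ (t_ab L u a b)).
  by apply: ereal_inf_lbound; exists (a, b).
apply: ereal_inf_lbound; exists (atomic R [seq (x i, c i) | i <- enum I]).
  exact: atomic_in_M_ab (ltW a0) c0 xab cxu.
rewrite integral_atomic ?big_map ?big_enum//.
- exact: measurable_fun_inv_itv.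
- move=> y /=; rewrite in_itv/= => /andP[ay _].
  by rewrite invr_ge0 (le_trans (ltW a0)).
- by move=> w /mapP[i _ ->]; rewrite /= in_itv/=.
Qed.

(** * Supports of measures and existence of the index *)

(** Every point outside the support has a null ball around it, hence lies in a null ball with
    rational centre and radius; these are countably many. *)
Lemma negligible_setC_msupp (R : realType) (mu : {measure set R -> \bar R}) :
  mu.-negligible (~` msupp mu).
Proof.
pose F n : set R := if unpickle n is Some q then
  let B := ball (ratr q.1 : R) (ratr q.2 : R) in
  if mu B == 0%E then B else set0 else set0.
apply: (@negligibleS _ _ _ mu (\bigcup_n F n)); last first.
  apply: negligible_bigcup => n; rewrite /F.
  case: (unpickle n : option (rat * rat)) => [q|]; last exact: negligible_set0.
  case: ifPn => [/eqP B0|_]; last exact: negligible_set0.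
  by apply/negligibleP => //; exact: measurable_ball.
move=> x /existsNP[e /not_implyP[e0 /negP]]; rewrite -leNgt measure_le0 => /eqP Be0.
have [r] : exists r : rat, ratr r \in `]0, (e / 2)[ by apply: rat_in_itvoo; rewrite divr_gt0.
rewrite in_itv/= => /andP[r0 re].
have [q] : exists q : rat, ratr q \in `](x - ratr r), (x + ratr r)[.
  by apply: rat_in_itvoo; rewrite ltrD2l gtrN.
rewrite in_itv/= => /andP[qx xq].
exists (pickle (q, r)); first by [].
rewrite /F pickleK.
have qr : `|x - ratr q| < ratr r by rewrite ltr_norml; apply/andP; split; lra.
have -> : mu (ball (ratr q : R) (ratr r : R)) = 0%E.
  apply/eqP; rewrite -measure_le0 -Be0 le_measure ?inE//; try exact: measurable_ball.
  move=> y; rewrite /ball/= => qy.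
  have -> : x - y = (x - ratr q) + (ratr q - y) by rewrite addrA subrK.
  by rewrite (le_lt_trans (ler_normD _ _))//; move: qr qy re; lra.
by rewrite eqxx /ball/= distrC.
Qed.

(** The complement of the support is null, so a finite support makes the measure a sum of point
    masses. *)
Lemma in_M_ab_atoms (R : realType) (L : nat) (u : nat -> R) (a b : R)
    (mu : {measure set R -> \bar R}) (K : nat) :
  0 <= a -> in_M_ab L.+1 u a b mu -> (msupp mu #= `I_K)%card ->
  exists c x : 'I_K -> R, [/\ injective x, forall j, a <= x j <= b,
    forall j, 0 < c j &
    forall k, (k < L.+1)%N -> \sum_j c j * x j ^+ k = u k].
Proof.
move=> a0 [muab mom] /card_esym/card_set_bijP[f [fsupp finj fsurj]].
pose x (j : 'I_K) := f j.
have xinj : injective x.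
  by move=> i j xij; apply/val_inj/(finj _ _ _ _ xij); rewrite inE/=.
have xsupp j : msupp mu (x j) by apply: fsupp => /=.
have suppx y : msupp mu y -> exists j, y = x j.
  by move=> /fsurj[i /= iK <-]; exists (Ordinal iK).
(* The total mass is the moment u_0, hence finite, and the point masses are real numbers. *)
have muT : (mu setT < +oo)%E.
  rewrite -(setvU `[a, b]%classic) (@le_lt_trans _ _
    (mu (~` `[a, b]%classic) + mu `[a, b]%classic))%E//.
    by apply: measureU2 => //; exact: measurableC.
  rewrite [X in (X + _)%E]muab add0e.
  have := mom 0%N isT; under eq_integral do rewrite expr0.
  by rewrite integral_cst//= mul1e => ->; rewrite ltry.
have mufin A : measurable A -> mu A \is a fin_num.
  by move=> mA; rewrite ge0_fin_numE// (le_lt_trans _ muT)// le_measure ?inE.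
pose c j := fine (mu [set x j]).
have cE j : (c j)%:E = mu [set x j] by rewrite fineK// mufin.
have c0 j : 0 <= c j by rewrite -lee_fin cE.
have muE A : measurable A -> mu A = (\sum_j (c j)%:E * \d_(x j) A)%E.
  move=> mA.
  have -> : mu A = mu (\big[setU/set0]_j (A `&` [set x j])).
    set B := \big[setU/set0]_j _.
    have mB : measurable B.
      by apply: bigsetU_measurable => i _; exact: measurableI.
    rewrite (measureDI mu mA mB) (_ : A `&` B = B); last first.
      apply/setIidPr/(big_ind (fun C : set R => C `<=` A)) => // C D CA DA.
      by rewrite subUset.
    rewrite [X in (X + _)%E]measure_negligible ?add0e//; first exact: measurableD.
    apply: negligibleS (negligible_setC_msupp R mu) => y [Ay nBy] /suppx[j yj].
    by apply: nBy; rewrite /B (bigD1 j)//=; left.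
  rewrite (measure_bigsetU_ord mu xpredT)//; last 2 first.
  - by move=> i; exact: measurableI.
  - by move=> i j _ _ [y [[_ ->] [_ /xinj]]].
  apply: eq_bigr => j _; rewrite diracE; have [xA|xA] := pselect (A (x j)).
    by rewrite mem_set// mule1 cE; congr (mu _); apply/seteqP; split => [y []|y ->].
  rewrite memNset// mule0 -(measure0 mu); congr (mu _).
  by apply/seteqP; split => // y [Ay yx]; apply: xA; rewrite -yx.
have xab j : a <= x j <= b.
  apply/negPn/negP => xj.
  have : open (~` `[a, b]%classic) by exact/closed_openC/itv_closed.
  have nx : (~` `[a, b]%classic) (x j) by rewrite /= in_itv/=; exact/negP.
  rewrite openE => /(_ _ nx)/nbhs_ballP[e /= e0 eab].
  have := xsupp j e e0; rewrite ltNge => /negP; apply.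
  rewrite -muab le_measure ?inE//; first exact: measurable_ball.
  exact: measurableC.
exists c, x; split => //.
  move=> j.
  (* [e] separates [x j] from the other atoms, so the ball carries exactly the mass [c j]; the value
     1 at i = j is a dummy. *)
  have [i|e e0 ex] := finite_pos_lb R 'I_K
    (fun i => if i == j then 1 else `|x j - x i|).
    by case: eqVneq => // ij; rewrite normr_gt0 subr_eq0 (inj_eq xinj) eq_sym.
  rewrite -lte_fin (lt_le_trans (xsupp j e e0))//.
  rewrite muE; last exact: measurable_ball.
  rewrite (bigD1 j)//= big1 => [|i ij].
    by rewrite adde0 diracE mem_set ?mule1//; exact: ballxx.
  rewrite diracE memNset ?mule0// /ball/= => xe.
  by have := ex i; rewrite (negbTE ij) ltNge (ltW xe).
pose s := [seq (x i, c i) | i <- enum 'I_K].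
move=> k kL; apply: EFin_inj; rewrite -mom//.
rewrite (eq_measure_integral (atomic R s)).
  rewrite integral_atomic// ?big_map ?big_enum//.
  - by move=> y /=; rewrite in_itv/= => /andP[ay _]; rewrite exprn_ge0// (le_trans a0).
  - by move=> w /mapP[i _ ->]; rewrite /= in_itv/=.
move=> A mA _; rewrite atomicE big_map big_enum muE//.
by apply: eq_bigr => i _; rewrite /= ger0_norm.
Qed.

(** A point that is no atom has a ball free of atoms, which is null. *)
Lemma finite_msupp_atomic (R : realType) (s : seq (R * R)) :
  finite_set (msupp (atomic R s)).
Proof.
apply: (sub_finite_set _ (finite_seq [seq w.1 | w <- s])) => y ysupp /=.
apply/negPn/negP => ys.
have [i|e e0 ex] := finite_pos_lb R 'I_(size s) (fun i => `|y - (nth 0 s i).1|).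
  rewrite normr_gt0 subr_eq0; apply: contra ys => /eqP ->.
  by rewrite map_f// mem_nth.
have := ysupp e e0; rewrite atomicE (big_nth 0) big_mkord big1 ?ltxx// => i _.
by rewrite diracE memNset ?mule0// /ball/=; have := ex i; rewrite ltNge => /[swap]/ltW ->.
Qed.

(** This rules out the default value of [ind_inf]: positivity gives a representing measure of finite
    support, so a least cardinality exists. *)
Lemma is_ind_inf_ind_inf (R : realType) (n : nat) (s : nat -> R) :
  pos_inf n.+1 s -> is_ind_inf n.+1 s (ind_inf n.+1 s).
Proof.
move=> [a [b [a0 [ab sp]]]].
have [c [x [c0 xab cx]]] := pos_ab_atomic R n s a b (ltW a0) (ltW ab) sp.
pose t := [seq (x i, c i) | i <- enum 'I_n.+1].
have tM : in_M_inf n.+1 s (atomic R t).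
  by exists a, b; do 2!split => //; exact: atomic_in_M_ab (ltW a0) c0 xab cx.
pose P K := `[< exists mu, in_M_inf n.+1 s mu /\ (msupp mu #= `I_K)%card >].
have PK : exists K, P K.
  have [K tK] := finite_msupp_atomic R t.
  by exists K; apply/asboolP; exists (atomic R t).
apply: (@xgetPex _ 0%N [set K | is_ind_inf n.+1 s K]).
case: (ex_minnP PK) => K /asboolP KM Kmin.
by exists K; split => // mu K' muM muK; apply: Kmin; apply/asboolP; exists mu.
Qed.

(** * The exact value of [t_inf] from 2K moments *)

Lemma integral_poly_in_M_ab (R : realType) (L : nat) (u : nat -> R) (a b : R)
    (mu : {measure set R -> \bar R}) (p : {poly R}) :
  0 <= a -> in_M_ab L u a b mu -> (size p <= L)%N ->
  mu.-integrable `[a, b]%classic (fun x : R => p.[x]%:E) /\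
  (\int[mu]_(x in `[a, b]) p.[x]%:E = (\sum_(i < L) p`_i * u i)%:E)%E.
Proof.
move=> a0 [_ mom] sp.
have intX (i : 'I_L) : mu.-integrable `[a, b]%classic (fun x : R => (x ^+ i)%:E).
  apply/integrableP; split; first exact/measurable_EFinP.
  rewrite (eq_integral (fun x : R => (x ^+ i)%:E)) ?mom ?ltry// => x /[!inE]/=.
  rewrite in_itv/= => /andP[ax _].
  by rewrite ger0_norm// exprn_ge0// (le_trans a0).
have intpX (i : 'I_L) : mu.-integrable `[a, b]%classic
    (fun x : R => (p`_i)%:E * (x ^+ i)%:E)%E.
  exact: integrableZl.
have pE : (fun x : R => p.[x]%:E) =
    (fun x : R => \sum_(i < L) (p`_i)%:E * (x ^+ i)%:E)%E.
  apply/funext => x; rewrite (horner_coef_wide _ sp) -sumEFin.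
  by apply: eq_bigr => i _; rewrite EFinM.
rewrite pE; split; first exact: integrable_sum.
rewrite integral_sum// -sumEFin; apply: eq_bigr => i _.
by rewrite integralZl// mom// EFinM.
Qed.

Lemma t_inf_atomic (R : realType) (K : nat) (u : nat -> R) (c x : 'I_K -> R) :
  (forall j, 0 <= c j) -> (forall j, 0 < x j) ->
  (forall k, (k < 2 * K)%N -> \sum_j c j * x j ^+ k = u k) ->
  t_inf (2 * K) u = (\sum_j c j / x j)%:E.
Proof.
move=> c0 x0 cxu; apply/eqP; rewrite eq_le t_inf_le_atomic//=.
apply: le_ereal_inf_tmp => _ [[a b] [/= a0 ab] <-].
apply: le_ereal_inf_tmp => _ [mu muM <-].
pose P : {poly R} := \prod_j (1 - (x j)^-1 *: 'X).
have Px y : P.[y] = \prod_j (1 - y / x j).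
  rewrite /P horner_prod; apply: eq_bigr => j _.
  by rewrite !hornerE mulrC.
have PE y : (1 - P ^+ 2).[y] = 1 - P.[y] ^+ 2.
  by rewrite hornerD hornerN horner_exp -polyC1 hornerC.
(* P(0) = 1, so X divides 1 - P^2; the quotient [q] has degree at most 2K - 1, the index of the last
   given moment. *)
have : root (1 - P ^+ 2) 0.
  rewrite /root PE Px big1 ?expr1n ?subrr// => j _.
  by rewrite mul0r subr0.
move=> /factor_theorem[q]; rewrite subr0 => qE.
have qy y : q.[y] * y = 1 - P.[y] ^+ 2.
  by rewrite -PE qE hornerMX.
have sP : (size P <= K.+1)%N.
  apply: (leq_trans (size_prod_leq _ _)).
  have : (\sum_(i < K) size (1 - (x i)^-1 *: 'X)%R <= K * 2)%N.
    rewrite -[X in (_ <= X * _)%N]card_ord -sum_nat_const; apply: leq_sum => j _.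
    rewrite (leq_trans (size_polyD _ _))// geq_max size_poly1/= size_polyN.
    by rewrite (leq_trans (size_scale_leq _ _))// size_polyX.
  rewrite card_ord leq_subLR => sK; apply: leq_ltn_trans sK _; lia.
have sq : (size q <= 2 * K)%N.
  have [->|q0] := eqVneq q 0; first by rewrite size_poly0.
  rewrite -ltnS -(size_mulX q0) -qE.
  rewrite (leq_trans (size_polyD _ _))// geq_max size_poly1/= size_polyN.
  rewrite expr2 (leq_trans (size_polyMleq _ _))// -subn1 leq_subLR.
  by apply: leq_trans (leq_add sP sP) _; lia.
have [qint qI] := integral_poly_in_M_ab R _ _ _ _ _ _ (ltW a0) muM sq.
(* q(x_j) = 1/x_j because P vanishes at x_j. *)
have <- : \sum_(i < 2 * K) q`_i * u i = \sum_j c j / x j.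
  transitivity (\sum_j c j * q.[x j]).
    under [RHS]eq_bigr do rewrite (horner_coef_wide _ sq) mulr_sumr.
    rewrite exchange_big/=; apply: eq_bigr => i _; rewrite -cxu// mulr_sumr.
    by apply: eq_bigr => j _; rewrite mulrCA.
  apply: eq_bigr => j _; congr (_ * _).
  have xj : x j != 0 by rewrite gt_eqF.
  apply: (mulIf xj); rewrite qy mulVf ?gt_eqF// Px.
  by rewrite (bigD1 j)//= divff ?gt_eqF// subrr mul0r expr0n subr0.
rewrite -qI.
have inv0 y : `[a, b]%classic y -> 0 <= y^-1.
  by rewrite /= in_itv/= => /andP[ay _]; rewrite invr_ge0 (le_trans (ltW a0)).
(* An infinite integral is split off, as the comparison of integrals below asks for integrability of
   1/y. *)
have [->|fi] := eqVneq (\int[mu]_(y in `[a, b]) (y^-1)%:E)%E +oo%E.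
  by rewrite leey.
apply: le_integral => //.
  apply/integrableP; split.
    by apply/measurable_EFinP; exact: measurable_fun_inv_itv.
  rewrite (eq_integral (fun y : R => (y^-1)%:E)) ?ltey// => y /[!inE] /inv0 y0.
  by rewrite /= ger0_norm.
move=> y /[!inE]/= /[!in_itv]/= /andP[ay _].
have y0 : 0 < y := lt_le_trans a0 ay.
rewrite lee_fin -(ler_pM2r y0) qy mulVf ?gt_eqF// gerBl; exact: sqr_ge0.
Qed.

(** * Strict inequality for fewer than 2K moments *)

(* The weights of tau are minus the values at 0 of the Lagrange basis on the
   2K nodes x_j and x_j + d, with d smaller than all gaps.  The weight at
   x_j + d is nonnegative because, for i != j, the nodes x_i and x_i + d lie on
   the same side of x_j + d. *)
Lemma lower_moment_perturbation (R : realType) (K : nat) (x : 'I_K -> R) :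
  injective x -> (forall j, 0 < x j) ->
  exists (z : 'I_K * bool -> R) (tau : 'I_K * bool -> R),
    [/\ forall l, 0 < z l, forall j, z (j, false) = x j,
      forall j, 0 <= tau (j, true) &
      forall k, (k < 2 * K)%N -> \sum_l tau l * z l ^+ k = - (k == 0%N)%:R].
Proof.
move=> xi x0.
have [ij|d d0 dx] := finite_pos_lb R ('I_K * 'I_K)%type
  (fun ij => if ij.1 == ij.2 then 1 else `|x ij.1 - x ij.2|).
  by case: eqVneq => // ne; rewrite normr_gt0 subr_eq0 (inj_eq xi).
have dxx i j : i != j -> d < `|x i - x j|.
  by move=> ij; have := dx (i, j); rewrite /= (negbTE ij).
pose z (l : 'I_K * bool) := x l.1 + (if l.2 then d else 0).
have z0 l : 0 < z l by rewrite ltr_wpDr//; case: ifP => // _; exact: ltW.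
have zi : injective z.
  move=> [i p] [j q]; rewrite /z/= => zz.
  have ij : i = j.
    apply/eqP/negPn/negP => ij; have := dxx _ _ ij; rewrite ltNge => /negP; apply.
    by rewrite ler_norml; move: zz; case: p; case: q => ?; apply/andP; split; lra.
  by subst j; move: zz; case: p; case: q => // ?; exfalso; lra.
pose tau l := - \prod_(r | r != l) ((0 - z r) / (z l - z r)).
exists z, tau; split => //.
- by move=> j; rewrite /z/= addr0.
(* The factor at (j, false) is -x_j/d and absorbs the minus sign; the others are grouped in pairs
   over i != j. *)
- move=> j; rewrite /tau (bigD1 (j, false)) ?xpair_eqE ?andbF//= -mulNr mulr_ge0//.
    rewrite /z/= addr0 sub0r addrAC subrr add0r -mulNr opprK.
    by rewrite divr_ge0// ltW.
  rewrite (eq_bigl (fun r => (r.1 != j) && xpredT r.2)); last first.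
    by move=> [i p]; rewrite /= !xpair_eqE; case: p; case: (i == j).
  rewrite -(pair_big (fun i => i != j) xpredT
    (fun i p => (0 - z (i, p)) / (z (j, true) - z (i, p))))/=.
  apply: prodr_ge0 => i ij; rewrite big_bool/= /z/= addr0 mulf_div divr_ge0//.
    have := x0 i; nra.
  have := dxx _ _ ij; rewrite lter_normr => /orP[] ?; nra.
move=> k kK; rewrite -[in RHS]expr0n.
have := @lagrange_interpolation _ _ z 'X^k 0 zi.
rewrite size_polyXn card_prod card_ord card_bool mulnC => /(_ kK).
rewrite hornerXn => ->; rewrite -sumrN; apply: eq_bigr => l _.
by rewrite hornerXn /tau mulNr mulrC.
Qed.

(** Weights c_j/x_j at the x_j have moments sum_j c_j/x_j, u_0, ..., u_(L-1). As L < 2K, adding e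
    [tau] lowers the first by e and keeps the others; multiplying by t then gives a measure with
    moments [u]. *)
Lemma t_inf_lt_atomic (R : realType) (K L : nat) (u : nat -> R)
    (c x : 'I_K -> R) : injective x ->
  (forall j, 0 < c j) -> (forall j, 0 < x j) -> (L < 2 * K)%N ->
  (forall k, (k < L)%N -> \sum_j c j * x j ^+ k = u k) ->
  (t_inf L u < (\sum_j c j / x j)%:E)%E.
Proof.
move=> xi c0 x0 LK cxu.
have [z [tau [z0 zx tau0 tauz]]] := lower_moment_perturbation R K x xi x0.
(* [e] keeps the weights at the original nodes nonnegative; at the shifted nodes [tau] itself is
   nonnegative. *)
have [j|e e0 ec] := finite_pos_lb R 'I_K
  (fun j => c j / x j / (1 + `|tau (j, false)|)).
  by rewrite !divr_gt0// ltr_pwDl.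
pose w l := (if l.2 then 0 else c l.1 / x l.1) + e * tau l.
have w0 l : 0 <= w l.
  rewrite /w; case: l => j [] /=; first by rewrite add0r mulr_ge0// ltW.
  have := ec j; rewrite ltr_pdivlMr ?ltr_pwDl// => ecj.
  have := ler_norm (- tau (j, false)); rewrite normrN; nra.
have wE k : (k < 2 * K)%N ->
    \sum_l w l * z l ^+ k = \sum_j c j / x j * x j ^+ k - e * (k == 0%N)%:R.
  move=> kK; under eq_bigr do rewrite mulrDl -mulrA.
  rewrite big_split/= -mulr_sumr tauz// mulrN; congr (_ - _).
  pose F j p := (if p then 0 else c j / x j) * z (j, p) ^+ k.
  transitivity (\sum_l F l.1 l.2); first by apply: eq_bigr => -[].
  rewrite -(pair_bigA _ F)/=.
  by apply: eq_bigr => j _; rewrite big_bool/= /F mul0r add0r zx.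
apply: (@le_lt_trans _ _ (\sum_l w l * z l / z l)%:E).
  apply: t_inf_le_atomic => // [l|k kL]; first by rewrite mulr_ge0// ltW.
  under eq_bigr do rewrite -mulrA -exprS.
  rewrite wE ?(leq_ltn_trans kL)//= mulr0 subr0 -cxu//.
  by apply: eq_bigr => j _; rewrite exprS mulrA divfK// gt_eqF.
have := wE 0%N (leq_trans (ltn0Sn _) LK).
rewrite eqxx mulr1; under eq_bigr do rewrite expr0 mulr1.
under [X in _ = X - _]eq_bigr do rewrite expr0 mulr1.
under [X in (X%:E < _)%E]eq_bigr do rewrite mulfK ?gt_eqF//.
by move=> ->; rewrite lte_fin ltrBlDr ltrDl.
Qed.

(* s = (s_0,...,s_n) has length n+1.  K = ind_oo(s), N = 2K-1 (an integer).
   (i)  for k in N ∩ [n-N, n-1]:  t_oo((s_{k+1},...,s_n)) < s_k   (length n-k)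
   (ii) for k in N ∩ [0, n-N-1]:  s_k = t_oo((s_{k+1},...,s_{k+N+1}))  (length N+1 = 2K) *)
Theorem theorem5p6 (R : realType) (n : nat) (s : nat -> R) :
  (forall k : nat, (k <= n)%N -> 0 <= s k) ->
  pos_inf n.+1 s ->
  let K := ind_inf n.+1 s in
  let N : int := (2 * K)%:Z - 1 in
  (forall k : nat, n%:Z - N <= k%:Z -> (k < n)%N ->
     (t_inf (n - k) (fun i => s (k + 1 + i)%N) < (s k)%:E)%E) /\
  (forall k : nat, k%:Z <= n%:Z - N - 1 ->
     (s k)%:E = t_inf (2 * K) (fun i => s (k + 1 + i)%N)).
Proof.
move=> _ sp K N.
have [[mu [[a [b [a0 [ab muM]]]] muK]] _] := is_ind_inf_ind_inf R n s sp.
have [c [x [xi xab c0 cx]]] := in_M_ab_atoms R n s a b mu K (ltW a0) muM muK.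
have x0 j : 0 < x j by have /andP[+ _] := xab j; exact: lt_le_trans.
(* The weights c_j x_j^(k+1) represent s_(k+1), ..., s_n, and their integral of 1/t is s_k. *)
have cx0 k j : 0 < c j * x j ^+ (k + 1) by rewrite mulr_gt0// exprn_gt0.
have cxs k i : (k + 1 + i <= n)%N ->
    \sum_j c j * x j ^+ (k + 1) * x j ^+ i = s (k + 1 + i)%N.
  by move=> kin; rewrite -cx//; apply: eq_bigr => j _; rewrite -mulrA -exprD.
have cxV k : (k <= n)%N -> \sum_j c j * x j ^+ (k + 1) / x j = s k.
  move=> kn; rewrite -cx//; apply: eq_bigr => j _.
  by rewrite addn1 exprSr mulrA mulfK// gt_eqF.
split=> k kN.
  move=> kn; rewrite -(cxV _ (ltnW kn)).
  (* Here n - k <= N = 2K - 1, so fewer than 2K moments are prescribed. *)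
  by apply: t_inf_lt_atomic => // [|i ik]; [move: kN; rewrite /N; lia|apply: cxs; lia].
(* The 2K shifted moments end at index k + 2K, still at most n. *)
have {}kN : (k + 2 * K <= n)%N by move: kN; rewrite /N; lia.
rewrite -cxV ?(leq_trans (leq_addr _ _) kN)//; apply/esym/t_inf_atomic => //.
  by move=> j; exact: ltW.
by move=> i iK; apply: cxs; lia.
Qed.
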